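(* Let $(X,d)$ be a cone metric space (with associated real Banach space $E$ and cone $P\subset E$). If a sequence $\{x_n\}$ in $X$ is bounded, then $LIM^{r}x_n\neq\emptyset$ for some $r\in E$ with $0\ll r$.
   Context: Let $E$ be a real Banach space. A subset $P\subset E$ is a cone if (i) $P$ is closed, nonempty and $P\neq\{0\}$; (ii) $a,b\in\mathbb{R}$, $a,b\ge 0$, $x,y\in P$ implies $ax+by\in P$; (iii) $x\in P$ and $-x\in P$ implies $x=0$. Write $x\le y$ if $y-x\in P$, $x<y$ if $x\le y$ and $x\ne y$, and $x\ll y$ if $y-x\in \mathrm{int}\,P$ (the interior of $P$). A cone metric space $(X,d)$ is a nonempty set $X$ with a map $d:X\times X\to E$ such that for all $x,y,z\in X$: $0\le d(x,y)$, and $d(x,y)=0$ iff $x=y$; $d(x,y)=d(y,x)$; $d(x,y)\le d(x,z)+d(z,y)$. A sequence $\{x_n\}$ in $X$ is bounded if there exists $k\in E$ with $0\ll k$ such that $d(x_m,x_n)\ll k$ for all $m,n\in\mathbb{N}$. For $r\in E$ with $0\ll r$ or $r=0$, a sequence $\{x_n\}$ in $X$ is $r$-convergent to $x\in X$ if for every $\epsilon\in E$ with $0\ll\epsilon$ there is $k\in\mathbb{N}$ such that $d(x_n,x)\ll r+\epsilon$ for all $n\ge k$. The $r$-limit set is $LIM^{r}x_n=\{x\in X: \{x_n\}\text{ is } r\text{-convergent to } x\}$. *)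

(* Defs.v *)
From mathcomp Require Import all_boot all_order all_algebra.
From mathcomp Require Import boolp classical_sets reals topology normedtype.

Set Implicit Arguments.
Unset Strict Implicit.
Unset Printing Implicit Defensive.

Import Order.TTheory GRing.Theory Num.Theory.
Import numFieldNormedType.Exports.

Local Open Scope classical_set_scope.
Local Open Scope ring_scope.

Record is_cone (R : realType) (E : completeNormedModType R) (P : set E) :
    Prop := IsCone {
  cone_closed : closed P;
  cone_nonempty : P !=set0;
  cone_neq0 : P <> [set 0];
  cone_comb : forall (a b : R) (x y : E),
    0 <= a -> 0 <= b -> P x -> P y -> P (a *: x + b *: y);
  cone_pointed : forall x : E, P x -> P (- x) -> x = 0
}.

(* x <= y for the partial order induced by P *)
Definition cone_le (R : realType) (E : completeNormedModType R) (P : set E)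
  (x y : E) : Prop := P (y - x).

(* x << y *)
Definition cone_ll (R : realType) (E : completeNormedModType R) (P : set E)
  (x y : E) : Prop := interior P (y - x).

Record is_cone_metric (R : realType) (E : completeNormedModType R) (P : set E)
    (X : Type) (d : X -> X -> E) : Prop := IsConeMetric {
  cone_metric_inhabited : inhabited X;
  cone_metric_ge0 : forall x y : X, cone_le P 0 (d x y);
  cone_metric_eq0 : forall x y : X, d x y = 0 <-> x = y;
  cone_metric_sym : forall x y : X, d x y = d y x;
  cone_metric_triangle : forall x y z : X, cone_le P (d x y) (d x z + d z y)
}.

Definition cone_bounded (R : realType) (E : completeNormedModType R)
    (P : set E) (X : Type) (d : X -> X -> E) (x_ : nat -> X) : Prop :=
  exists k : E, cone_ll P 0 k /\ forall m n : nat, cone_ll P (d (x_ m) (x_ n)) k.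

(* Meaningful for r = 0 or 0 << r; this condition on r is left to the uses. *)
Definition r_convergent (R : realType) (E : completeNormedModType R)
    (P : set E) (X : Type) (d : X -> X -> E) (r : E) (x_ : nat -> X) (x : X) :
    Prop :=
  forall eps : E, cone_ll P 0 eps ->
    exists k : nat, forall n : nat, (k <= n)%N -> cone_ll P (d (x_ n) x) (r + eps).

Definition LIM (R : realType) (E : completeNormedModType R)
    (P : set E) (X : Type) (d : X -> X -> E) (r : E) (x_ : nat -> X) : set X :=
  [set x | r_convergent P d r x_ x].

(* Main.v *)
Require Import Defs.
From mathcomp Require Import all_boot all_order all_algebra.
From mathcomp Require Import boolp classical_sets reals topology normedtype.

Import GRing.Theory Num.Theory.
Import numFieldNormedType.Exports.

Local Open Scope classical_set_scope.
Local Open Scope ring_scope.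

(** A bound [k] for the sequence is itself a suitable degree [r], and any term, say [x_ 0], is then
    a limit: [k - d (x_ n) (x_ 0)] is interior to [P] for every [n], and adding [eps] keeps it
    interior. This rests on the inclusion of int P + P in int P, which is [interior_cone_add]. *)

Lemma cone_add (R : realType) (E : completeNormedModType R) (P : set E)
    (hP : is_cone P) (x y : E) : P x -> P y -> P (x + y).
Proof.
move=> Px Py.
by have := cone_comb hP ler01 ler01 Px Py; rewrite !scale1r.
Qed.

(** Translation by [y] carries a neighbourhood of [x] inside [P] to one of [x + y], and its points
    stay in [P] because [P] is closed under addition. *)
Lemma interior_cone_add (R : realType) (E : completeNormedModType R)
    (P : set E) (hP : is_cone P) (x y : E) :
  interior P x -> P y -> interior P (x + y).
Proof.
rewrite /interior /= => Px Py.
have sub_cvg : (fun z : E => z - y) @ (x + y) --> x.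
  by rewrite -{2}(addrK y x); apply: cvgB; [exact: cvg_id | exact: cvg_cst].
have Pxy : nbhs (x + y) ((fun z : E => z - y) @^-1` P) by exact: sub_cvg.
apply: (filterS _ Pxy) => z /= Pzy.
by rewrite -(subrK y z); exact: cone_add.
Qed.

Theorem theorem3p1 (R : realType) (E : completeNormedModType R) (P : set E)
    (hP : is_cone P) (X : Type) (d : X -> X -> E) (hd : is_cone_metric P d)
    (x_ : nat -> X) (hx : cone_bounded P d x_) :
  exists r : E, cone_ll P 0 r /\ LIM P d r x_ <> set0.
Proof.
have [k [k_gt0 dk]] := hx.
exists k; split=> //; apply/eqP/set0P; exists (x_ 0%N) => eps eps_gt0.
(* The bound holds for all pairs of indices, so rank 0 suffices; [addrAC] splits the difference as
   [(k - d (x_ n) (x_ 0)) + eps]. *)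
exists 0%N => n _; rewrite /cone_ll addrAC.
apply: interior_cone_add => //; first exact: dk.
by move/interior_subset: eps_gt0; rewrite subr0.
Qed.
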